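(* In the setting of top and bottom sequences given in the context, fix an index $i$. Assume: (C3) $\hat R_{i+1}d_i=\hat d_i\hat R_i$ and $E_{i+1}\hat d_i=d_iE_i$; and that, for some unbounded operator $D_i:\mathcal H_i\to\mathcal H_{i+1}$ with domain $\mathrm{dom}(D_i)$, the commutation property $I_{i+1}D_i=d_iI_i$ holds on $\mathrm{dom}(D_i)$. Then $\hat I_{i+1}D_i=\hat d_i\hat I_i$ on $\mathrm{dom}(D_i)$. As a consequence, if moreover, for all indices $j$, (A1) $\hat R_j:X_j\to\hat X_j$ is continuous, with operator norm $\|\hat R_j\|$; (A2) $E_j\hat I_jx_p=I_jx_p$ for all $x_p\in\mathcal P^{k_j}$; (A3) $I_j:\mathcal H_j\to X_j$ is continuous for the norms $\|\cdot\|_{\mathcal H,j}$ and $\|\cdot\|_{X,j}$, with operator norm $\|I_j\|$; and if $P_{i+1}$ is polynomially consistent, i.e. $P_{i+1}I_{i+1}v_p=v_p$ for all $v_p\in\mathcal P^{k_{i+1}}$, then $$\|\hat P_{i+1}\hat d_i\hat I_iv-D_iv\|_{\mathcal L,i+1}\le\left(\|P_{i+1}\|\,\|\hat R_{i+1}\|\,\|I_{i+1}\|+1\right)\omega_{i+1}(D_iv)\qquad\forall v\in\mathrm{dom}(D_i),$$ where $\omega_{i+1}(\xi):=\inf_{\xi_p\in\mathcal P^{k_{i+1}}}\|\xi-\xi_p\|_{\mathcal H,i+1}$ for all $\xi\in\mathcal H_{i+1}$.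
   Context: $(X_i,d_i)_i$ (top sequence) is a complex of real vector spaces with inner products $(\cdot,\cdot)_{X,i}$ and norms $\|\cdot\|_{X,i}$. $(\hat X_i)_i$ (bottom sequence) is a second sequence of real vector spaces, with linear maps $E_i:\hat X_i\to X_i$ (extensions) and $\hat R_i:X_i\to\hat X_i$ (reductions), and $\hat d_i:=\hat R_{i+1}d_iE_i$. The inner product on $\hat X_i$ is $(\hat x,\hat y)_{\hat X,i}:=(E_i\hat x,E_i\hat y)_{X,i}$, with norm $\|\hat x\|_{\hat X,i}=\|E_i\hat x\|_{X,i}$ (it is understood that this is an inner product, i.e. that $E_i$ is injective). For each $i$, $\mathcal H_i$ is a Hilbert space with norm $\|\cdot\|_{\mathcal H,i}$, $\mathcal P^{k_i}\subset\mathcal H_i$ is a (polynomial) linear subspace, and $I_i:\mathcal H_i\to X_i$ is a linear map (interpolator). $\mathcal L_i$ is an ''$L^2$-like'' space with inner product $(\cdot,\cdot)_{\mathcal L,i}$ and norm $\|\cdot\|_{\mathcal L,i}$ in which $\mathcal H_i$ is continuously embedded: $\|v\|_{\mathcal L,i}\le c_{\mathcal H,i}\|v\|_{\mathcal H,i}$ for all $v\in\mathcal H_i$. The interpolator of the bottom sequence is $\hat I_i:=\hat R_iI_i$. The potential reconstruction $P_i:X_i\to\mathcal P^{k_i}$ is a linear map, with operator norm $\|P_i\|$ when $\mathcal P^{k_i}$ is endowed with the norm $\|\cdot\|_{\mathcal L,i}$, and $\hat P_i:=P_iE_i:\hat X_i\to\mathcal P^{k_i}$.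
   Formalization: The ''+1'' in the bound fails for a general embedding constant (e.g. c_H = 2 with I = P = 0, P^k = {0}, D = id); the theorem proved has c_{H,i+1} in place of 1 in general, and the printed bound with 1 when c_{H,i+1} ≤ 1. *)

(* Defs.v *)
From HB Require Import structures.
From mathcomp Require Import all_boot all_order all_algebra.
From mathcomp Require Import all_classical all_reals all_analysis.

Set Implicit Arguments.
Unset Strict Implicit.
Unset Printing Implicit Defensive.

Import Order.TTheory GRing.Theory Num.Theory.
Import numFieldNormedType.Exports.
Local Open Scope classical_set_scope.
Local Open Scope ring_scope.

(* Not necessarily complete. *)
Record innerProductType (R : realType) := InnerProductType {
  ip_sort :> normedModType R;
  ip_dot : {dot ip_sort for idfun};
  ip_normE : forall x : ip_sort, `|x| = Num.sqrt (ip_dot x x)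
}.

Record hilbertType (R : realType) := HilbertType {
  hilbert_sort :> completeNormedModType R;
  hilbert_dot : {dot hilbert_sort for idfun};
  hilbert_normE : forall x : hilbert_sort, `|x| = Num.sqrt (hilbert_dot x x)
}.

(* An operator that is linear on its domain, a linear subspace; neither
   continuity nor closedness is required.  The values of [uop_fun] outside
   [uop_dom] are irrelevant. *)
Record unbounded_operator (R : realType) (U V : normedModType R) :=
  UnboundedOperator {
  uop_dom : submodClosed U;
  uop_fun :> U -> V;
  uop_linear : forall (a : R) (u v : U), u \in uop_dom -> v \in uop_dom ->
    uop_fun (a *: u + v) = a *: uop_fun u + uop_fun v
}.

(* [sup] is 0 on sets that are not bounded above: this is the operator norm
   only for continuous linear [f]. *)
Definition opnorm (R : realType) (V W : normedModType R) (f : V -> W) : R :=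
  sup [set `|f x| | x in [set x : V | `|x| <= 1]].

Definition best_approx (R : realType) (V : normedModType R)
    (S : submodClosed V) (xi : V) : R :=
  inf [set `|xi - xi_p| | xi_p in [set` S]].

Section BottomSequence.
Variables (R : realType) (X Xh : int -> innerProductType R).
Variables (H : int -> hilbertType R).
Variables (d : forall i, {linear X i -> X (i + 1)}).
Variables (E : forall i, {linear Xh i -> X i}).
Variables (Rh : forall i, {linear X i -> Xh i}).
Variables (Int : forall i, {linear H i -> X i}).
Variables (P : forall i, {linear X i -> H i}).

Definition hat_d (i : int) (x : Xh i) : Xh (i + 1) := Rh (i + 1) (d i (E i x)).

Definition hat_Int (i : int) (v : H i) : Xh i := Rh i (Int i v).

Definition hat_P (i : int) (x : Xh i) : H i := P i (E i x).

End BottomSequence.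

(* Main.v *)
(* On the domain of [D], the error is [P E Rh Int w - w] at [w = D v], and by
   (A2) and polynomial consistency the operator [P E Rh Int - 1] vanishes on the
   polynomial subspace: [D v] may therefore be replaced by [D v - x] for any
   polynomial [x].  The extension [E] does not contribute to the constant since
   it is an isometry. *)
Require Import Defs.
From HB Require Import structures.
From mathcomp Require Import all_boot all_order all_algebra.
From mathcomp Require Import all_classical all_reals all_analysis.

Set Implicit Arguments.
Unset Strict Implicit.
Unset Printing Implicit Defensive.

Import Order.TTheory GRing.Theory Num.Theory.
Import numFieldNormedType.Exports.
Local Open Scope classical_set_scope.
Local Open Scope ring_scope.

(** Without continuity of [f] the set may be unbounded; [sup] then has its default value 0. *)
Lemma opnorm_ge0 (R : realType) (V W : normedModType R) (f : V -> W) :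
  0 <= opnorm f.
Proof.
rewrite /opnorm; set A := (X in sup X).
have [[_ A_ub]|/sup_out ->//] := pselect (has_sup A).
apply: (le_trans (normr_ge0 (f 0))); apply: ub_le_sup => //.
by exists 0 => //=; rewrite normr0.
Qed.

Lemma norm_le_opnorm (R : realType) (V W : normedModType R)
    (f : {linear V -> W}) (x : V) :
  continuous f -> `|f x| <= opnorm f * `|x|.
Proof.
move=> f_cont.
have [->|x_neq0] := eqVneq x 0; first by rewrite linear0 !normr0 mulr0.
have x_gt0 : 0 < `|x| by rewrite normr_gt0.
have /linear_boundedP/pinfty_ex_gt0[r r_gt0 f_le] :=
  continuous_linear_bounded 0 (f_cont 0).
rewrite -ler_pdivrMr//.
have -> : `|f x| / `|x| = `|f (`|x|^-1 *: x)|.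
  by rewrite linearZ normrZ normfV normr_id mulrC.
apply: ub_le_sup; last first.
  exists (`|x|^-1 *: x) => //=.
  by rewrite normrZ normfV normr_id mulVf// normr_eq0.
(* The continuity bound [r] makes the supremum a genuine one. *)
exists r => _ [y /= y_le1 <-].
by rewrite (le_trans (f_le y))// ler_piMr// ltW.
Qed.

Lemma best_approx_ge0 (R : realType) (V : normedModType R)
    (S : submodClosed V) (xi : V) : 0 <= best_approx S xi.
Proof.
apply: lb_le_inf; first by exists `|xi - 0|, 0 => //=; exact: rpred0.
by move=> _ [x _ <-].
Qed.

(** For [c > 0], [a / c] is a lower bound of the distances; for [c = 0], the choice [x = 0]
    suffices. *)
Lemma le_mul_best_approx (R : realType) (V : normedModType R)
    (S : submodClosed V) (xi : V) (a c : R) : 0 <= c ->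
  (forall x, x \in S -> a <= c * `|xi - x|) -> a <= c * best_approx S xi.
Proof.
rewrite le_eqVlt => /predU1P[<- a_le|c_gt0 a_le].
  by have := a_le 0 (rpred0 S); rewrite !mul0r.
rewrite mulrC -ler_pdivrMr//.
apply: lb_le_inf; first by exists `|xi - 0|, 0 => //=; exact: rpred0.
by move=> _ [x Sx <-]; rewrite ler_pdivrMr// mulrC a_le.
Qed.

Lemma isometry_of_dot (R : realType) (V W : innerProductType R) (f : W -> V) :
  (forall x y, ip_dot W x y = ip_dot V (f x) (f y)) ->
  forall x, `|f x| = `|x|.
Proof. by move=> f_dot x; rewrite !ip_normE f_dot. Qed.

Theorem proposition8 (R : realType)
  (* top complex *)
  (X : int -> innerProductType R)
  (d : forall i, {linear X i -> X (i + 1)})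
  (d_complex : forall i (x : X i), d (i + 1) (d i x) = 0)
  (* bottom sequence, with the inner product pulled back along E *)
  (Xh : int -> innerProductType R)
  (E : forall i, {linear Xh i -> X i})
  (Rh : forall i, {linear X i -> Xh i})
  (Xh_dot : forall i (x y : Xh i), ip_dot (Xh i) x y = ip_dot (X i) (E i x) (E i y))
  (* Hilbert spaces, polynomial subspaces, interpolators *)
  (H : int -> hilbertType R)
  (Pk : forall i, submodClosed (H i))
  (Int : forall i, {linear H i -> X i})
  (* L^2-like spaces, with the continuous embeddings of the Hilbert spaces *)
  (L : int -> innerProductType R)
  (emb : forall i, {linear H i -> L i})
  (emb_inj : forall i, injective (emb i))
  (cH : int -> R)
  (emb_le : forall i (v : H i), `|emb i v| <= cH i * `|v|)
  (* potential reconstructions, valued in the polynomial subspaces, bounded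
     when these are endowed with the norm of L *)
  (P : forall i, {linear X i -> H i})
  (P_Pk : forall i (x : X i), P i x \in Pk i)
  (P_cont : forall i, continuous (fun x : X i => emb i (P i x)))
  (i : int)
  (C3_R : forall x : X i, Rh (i + 1) (d i x) = hat_d d E Rh (Rh i x))
  (C3_E : forall x : Xh i, E (i + 1) (hat_d d E Rh x) = d i (E i x))
  (D : unbounded_operator (H i) (H (i + 1)))
  (comm : forall v, v \in uop_dom D -> Int (i + 1) (D v) = d i (Int i v)) :
  (forall v, v \in uop_dom D ->
     hat_Int Rh Int (D v) = hat_d d E Rh (hat_Int Rh Int v))
  /\
  ((* A1 *) (forall j, continuous (Rh j : X j -> Xh j)) ->
   (* A2 *) (forall j (x : H j), x \in Pk j -> E j (hat_Int Rh Int x) = Int j x) ->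
   (* A3 *) (forall j, continuous (Int j : H j -> X j)) ->
   (* polynomial consistency *)
   (forall v : H (i + 1), v \in Pk (i + 1) -> P (i + 1) (Int (i + 1) v) = v) ->
   (* the literal constant 1 requires cH (i + 1) <= 1; cH (i + 1) is the general one *)
   let bound (c : R) := forall v, v \in uop_dom D ->
     `|emb (i + 1) (hat_P E P (hat_d d E Rh (hat_Int Rh Int v)) - D v)|
     <= (opnorm (fun x : X (i + 1) => emb (i + 1) (P (i + 1) x))
         * opnorm (Rh (i + 1)) * opnorm (Int (i + 1)) + c)
        * best_approx (Pk (i + 1)) (D v) in
   bound (cH (i + 1)) /\ (cH (i + 1) <= 1 -> bound 1)).
Proof.
have commute v : v \in uop_dom D ->
    hat_Int Rh Int (D v) = hat_d d E Rh (hat_Int Rh Int v).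
  by move=> Dv; rewrite /hat_Int comm// C3_R.
split=> // Rh_cont E_Pk Int_cont P_Int bound.
set K := opnorm (fun x => emb (i + 1) (P (i + 1) x)) * opnorm (Rh (i + 1))
  * opnorm (Int (i + 1)) in bound *.
have K_ge0 : 0 <= K by rewrite !mulr_ge0 ?opnorm_ge0.
have K_le w : `|emb (i + 1) (hat_P E P (hat_Int Rh Int w))| <= K * `|w|.
  apply: (le_trans (norm_le_opnorm (f := emb (i + 1) \o P (i + 1)) _
    (P_cont (i + 1)))).
  rewrite (isometry_of_dot (Xh_dot (i + 1))) /K -!mulrA.
  apply: ler_wpM2l; first exact: opnorm_ge0.
  apply: (le_trans (norm_le_opnorm _ (Rh_cont (i + 1)))).
  apply: ler_wpM2l; first exact: opnorm_ge0.
  exact: norm_le_opnorm (Int_cont (i + 1)).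
have le_err v x : v \in uop_dom D -> x \in Pk (i + 1) ->
    `|emb (i + 1) (hat_P E P (hat_d d E Rh (hat_Int Rh Int v)) - D v)|
    <= (K + cH (i + 1)) * `|D v - x|.
  move=> Dv Pk_x; rewrite -commute//.
  (* The polynomial [x] is reproduced by [P E Rh Int], so its two contributions cancel. *)
  have -> : hat_P E P (hat_Int Rh Int (D v)) - D v
      = hat_P E P (hat_Int Rh Int (D v - x)) - (D v - x).
    rewrite [in RHS]/hat_P [in RHS]/hat_Int !linearB /=.
    rewrite -!/(hat_Int Rh Int _) (E_Pk _ x)// P_Int// /hat_P.
    by rewrite opprK addrACA addNr addr0.
  rewrite linearB mulrDl (le_trans (ler_normB _ _))//.
  by rewrite lerD.
have boundH : bound (cH (i + 1)).
  (* No sign is assumed on [cH], while [le_mul_best_approx] asks for a nonnegative constant. *)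
  move=> v Dv; have [cH_ge0|cH_lt0] := leP 0 (cH (i + 1)).
    by apply: le_mul_best_approx => [|x Pk_x]; [exact: addr_ge0|exact: le_err].
  (* A negative embedding constant forces [H (i + 1)] to be trivial. *)
  have H0 (w : H (i + 1)) : w = 0.
    apply/eqP; rewrite -normr_le0 -(nmulr_rge0 _ cH_lt0).
    exact: le_trans (normr_ge0 _) (emb_le (i + 1) w).
  rewrite (H0 (_ - _)) linear0 normr0.
  (* The factor [K + cH (i + 1)] may be negative here, so the infimum must be exactly 0. *)
  suff -> : best_approx (Pk (i + 1)) (D v) = 0 by rewrite mulr0.
  apply/eqP; rewrite eq_le best_approx_ge0 andbT.
  apply: ge_inf; first by exists 0 => _ [x _ <-].
  by exists 0; [exact: rpred0|rewrite (H0 (_ - _)) normr0].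
split=> // cH_le1 v Dv; apply: le_trans (boundH v Dv) _.
by apply: ler_wpM2r; [exact: best_approx_ge0|rewrite lerD2l].
Qed.
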